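(* Let $G=(V,E)$ be a finite graph (undirected or directed, without loops) with $V=\{1,\dots,n\}$, let $\mathcal C$ be a storage code on $G$ over a finite alphabet $Q$, fix a proper coloring of $G$ and, for each color, a matrix from a family of orthogonal partitions of shape $(k,s)$ (distinct colors receiving distinct matrices), and let $\bar G$ and $\bar{\mathcal C}$ be the resulting interleaved graph and interleaved code. Then $\bar{\mathcal C}$ is a storage code on $\bar G$ (over the alphabet $Q^k$).
   Context: Storage codes: for a finite graph $G=(V,E)$ put $N(v)=\{u:(v,u)\in E\}$. A storage code on $G$ over $Q$ is a nonempty set $\mathcal C\subseteq Q^V$ such that for each $v\in V$ there is a function $f_v$ with $x_v=f_v((x_u)_{u\in N(v)})$ for all $x\in\mathcal C$. Orthogonal partitions: let $s\ge k\ge 1$. A set $\mathcal M$ of $k\times s$ matrices over $\mathbb N$ is a family of orthogonal partitions of $\{1,\dots,ks\}$ of shape $(k,s)$ if (1) every $A\in\mathcal M$ contains every element of $\{1,\dots,ks\}$ exactly once; (2) for all distinct $A,B\in\mathcal M$, every column of $A$ has common entries with exactly $k$ columns of $B$, and every such pair of intersecting columns has exactly one common element. Interleaved graph: fix a coloring $c(\cdot)$ of $V$ with colors $1,\dots,c$ such that adjacent vertices have different colors, and distinct matrices $M_1,\dots,M_c\in\mathcal M$. The graph $\bar G=(\bar V,\bar E)$ has $\bar V=\{1,\dots,n\}\times\{1,\dots,s\}$ and $((t,\mu),(t',\mu'))\in\bar E$ if and only if $(t,t')\in E$ and column $\mu$ of $M_{c(t)}$ intersects column $\mu'$ of $M_{c(t')}$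 (as sets of entries). Interleaved code: for any (not necessarily distinct) $x^1,\dots,x^{ks}\in\mathcal C$, let $\bar x\in (Q^k)^{\bar V}$ be the word that assigns to the vertex $(t,\mu)$ the vector $\bigl(x_t^{M_{c(t)}(1,\mu)},\dots,x_t^{M_{c(t)}(k,\mu)}\bigr)\in Q^k$. The code $\bar{\mathcal C}$ is the set of all words $\bar x$ obtained as $(x^1,\dots,x^{ks})$ ranges over $\mathcal C^{ks}$. *)

(* Defs.v *)
From mathcomp Require Import all_boot all_algebra.
From mathcomp Require Import classical_sets.

Set Implicit Arguments.
Unset Strict Implicit.
Unset Printing Implicit Defensive.

Local Open Scope classical_set_scope.

(* A finite graph on V is its edge relation e : rel V, which need not be
   symmetric; the neighbourhood of v is {u | e v u}, and an undirected graph is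
   the case where e is symmetric. *)

Definition storage_code (V Q : finType) (e : rel V) (C : set {ffun V -> Q}) :
    Prop :=
  C !=set0 /\
  forall v : V, exists f : {ffun {u : V | e v u} -> Q} -> Q,
    forall x : {ffun V -> Q}, C x ->
      x v = f [ffun u : {u : V | e v u} => x (val u)].

Definition column (k s : nat) (A : 'M[nat]_(k, s)) (mu : 'I_s) : seq nat :=
  [seq A i mu | i : 'I_k].

Definition columns_meet (k s : nat) (A : 'M[nat]_(k, s)) (mu : 'I_s)
    (B : 'M[nat]_(k, s)) (nu : 'I_s) : bool :=
  has (mem (column A mu)) (column B nu).

Definition orthogonal_partitions (k s : nat) (F : set 'M[nat]_(k, s)) : Prop :=
  (forall A : 'M[nat]_(k, s), F A ->
     forall m : nat, 1 <= m <= k * s ->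
       exists! p : 'I_k * 'I_s, A p.1 p.2 = m) /\
  (forall A B : 'M[nat]_(k, s), F A -> F B -> A <> B ->
     forall mu : 'I_s,
       #|[pred nu : 'I_s | columns_meet A mu B nu]| = k /\
       forall nu : 'I_s, columns_meet A mu B nu ->
         exists! m : nat, m \in column A mu /\ m \in column B nu).

Definition proper_coloring (V : finType) (c : nat) (e : rel V)
    (col : V -> 'I_c) : Prop :=
  forall t t' : V, e t t' -> col t <> col t'.

Definition interleaved_graph (V : finType) (k s c : nat) (e : rel V)
    (col : V -> 'I_c) (M : 'I_c -> 'M[nat]_(k, s)) : rel (V * 'I_s) :=
  fun p q => e p.1 q.1 && columns_meet (M (col p.1)) p.2 (M (col q.1)) q.2.

Definition interleaved_word (V Q : finType) (k s c : nat) (col : V -> 'I_c)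
    (M : 'I_c -> 'M[nat]_(k, s)) (x : nat -> {ffun V -> Q}) :
    {ffun V * 'I_s -> {ffun 'I_k -> Q}} :=
  [ffun p => [ffun i : 'I_k => x (M (col p.1) i p.2) p.1]].

(* The codewords x^1, ..., x^(ks) are the values of x : nat -> _ at
   1, ..., k * s; the entries of the matrices of a family of orthogonal
   partitions lie in this range, so the other values of x are never read. *)
Definition interleaved_code (V Q : finType) (k s c : nat) (col : V -> 'I_c)
    (M : 'I_c -> 'M[nat]_(k, s)) (C : set {ffun V -> Q}) :
    set {ffun V * 'I_s -> {ffun 'I_k -> Q}} :=
  [set interleaved_word col M x | x in
     [set x : nat -> {ffun V -> Q} | forall m : nat, 1 <= m <= k * s -> C (x m)]].

(* Main.v *)
Require Import Defs.
From mathcomp Require Import all_boot all_algebra.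
From mathcomp Require Import boolp classical_sets.

(** A set of words is a storage code as soon as two codewords that agree on the
    neighbourhood of v agree at v. In the interleaved code, the i-th coordinate
    at (t, mu) is x^m_t with m = M_{c(t)}(i, mu), and x^m_t depends only on the
    x^m_u for u adjacent to t. Since m occurs in some column nu of M_{c(u)},
    that column meets column mu of M_{c(t)}, so x^m_u is a coordinate of the
    word at the neighbour (u, nu) of (t, mu). *)

Local Open Scope classical_set_scope.

Lemma storage_code_local (V Q : finType) (e : rel V) (C : set {ffun V -> Q}) :
  storage_code e C <->
  C !=set0 /\
  forall (v : V) (x y : {ffun V -> Q}), C x -> C y ->
    (forall u, e v u -> x u = y u) -> x v = y v.
Proof.
split=> [] [C0 H]; split=> // v.
  move=> x y Cx Cy xy; have [f fP] := H v.
  rewrite (fP _ Cx) (fP _ Cy); congr f; apply/ffunP=> u.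
  by rewrite !ffunE xy ?(valP u).
have [x0 Cx0] := C0.
pose restr (x : {ffun V -> Q}) := [ffun u : {u : V | e v u} => x (val u)].
(* Any codeword with the given restriction will do, since all of them agree at [v]; the default
   [x0 v] is reached only on restrictions of no codeword. *)
exists (fun y => if [pick x | `[< C x >] && (restr x == y)] is Some x
                 then x v else x0 v).
move=> x Cx; case: pickP => [z /andP[/asboolP Cz /eqP /ffunP zx]|/(_ x)].
  apply: H => // u vu.
  by have := zx (exist _ u vu); rewrite !ffunE /=.
by rewrite eqxx andbT; move/asboolP.
Qed.

(** Each of 1, ..., k * s occurs exactly once by definition; counting positions excludes any other
    entry. *)
Lemma orthogonal_partitions_entry (k s : nat) (F : set 'M[nat]_(k, s))
    (A : 'M[nat]_(k, s)) (i : 'I_k) (mu : 'I_s) :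
  orthogonal_partitions F -> F A -> 1 <= A i mu <= k * s.
Proof.
case=> F1 _ FA.
have /choice[g gP] (m : 'I_(k * s)) : exists p, A p.1 p.2 = m.+1.
  by have [p [Ap _]] := F1 A FA m.+1 (ltn_ord m); exists p.
have g_inj : injective g.
  by move=> a b gab; apply/val_inj/succn_inj; rewrite -!gP gab.
(* Each of the k * s values has its own position, so all positions are used. *)
have [|h _ hK] := inj_card_bij g_inj; first by rewrite card_prod !card_ord.
by have := gP (h (i, mu)); rewrite hK /= => ->; rewrite /= ltn_ord.
Qed.

Theorem proposition3p2 (n : nat) (e : rel 'I_n) (e_irr : irreflexive e)
  (Q : finType) (C : set {ffun 'I_n -> Q}) (C_storage : storage_code e C)
  (k s : nat) (k_ge1 : 1 <= k) (k_le_s : k <= s)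
  (F : set 'M[nat]_(k, s)) (F_orth : orthogonal_partitions F)
  (c : nat) (col : 'I_n -> 'I_c) (col_proper : proper_coloring e col)
  (M : 'I_c -> 'M[nat]_(k, s)) (M_in : forall a : 'I_c, F (M a))
  (M_inj : injective M) :
  storage_code (interleaved_graph e col M) (interleaved_code col M C).
Proof.
have /storage_code_local[[x0 Cx0] C_local] := C_storage.
apply/storage_code_local; split.
  by exists (interleaved_word col M (fun=> x0)); exists (fun=> x0).
move=> [t mu] _ _ [x Cx <-] [y Cy <-] xy.
rewrite !ffunE /=; apply/ffunP=> i; rewrite !ffunE.
have m_range :=
  orthogonal_partitions_entry _ _ _ _ i mu F_orth (M_in (col t)).
apply: C_local => [||u tu]; [exact: Cx | exact: Cy |].
(* The entry [M (col t) i mu] recurs in [M (col u)] at [(j, nu)], so coordinate [j] at [(u, nu)]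
   reads the same codeword. *)
have [[j nu] /= [Mm _]] := F_orth.1 _ (M_in (col u)) _ m_range.
have tu_adj : interleaved_graph e col M (t, mu) (u, nu).
  rewrite /interleaved_graph /= tu /=; apply/hasP.
  by exists (M (col u) j nu); rewrite ?Mm /column; apply/fintype.imageP;
    [exists j | exists i].
by have /ffunP/(_ j) := xy _ tu_adj; rewrite !ffunE /= Mm.
Qed.
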